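(* Let $P=(p_{ij})$ be a nonnegative $n\times n$ matrix, let $Y=(Y_1,\ldots,Y_n)'$ be a càdlàg function $[0,\infty)\to\mathbb R^n$ with $Y(0)=0$, and let $w\in\mathbb R_+^n$. Suppose that: (N1) $P$ is strictly upper triangular; (N2) the $j$-th column of $P$ contains exactly one strictly positive element for $j=2,\ldots,n$; (N3) $Y_j$ is nondecreasing for $j=2,\ldots,n$. Then the solution $(W,L)$ to the Skorokhod problem of $Y$ in $\mathbb R_+^n$ with reflection matrix $I-P'$ and initial condition $w$ is given by \[ L(t)=0\vee\sup_{0\le s\le t}\left[-(I-P')^{-1}Y(s)-(I-P')^{-1}w\right],\qquad W(t)=w+Y(t)+(I-P')L(t),\qquad t\ge0, \] where the supremum (and the maximum with $0$) is interpreted componentwise.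
   Context: $P'$ denotes the transpose of $P$. The solution to the Skorokhod problem of $Y$ in $\mathbb R^n_+$ with reflection matrix $I-P'$ and initial condition $w$ is the (known to be unique, when $P$ is nonnegative with spectral radius smaller than one) pair $(W,L)$ of càdlàg functions with: (S1) $W(t)=w+Y(t)+(I-P')L(t)$ for $t\ge0$; (S2) $W(t)\ge0$ for $t\ge0$ and $W(0)=w$; (S3) $L(0)=0$ and $L$ is (componentwise) nondecreasing; (S4) $\sum_{j=1}^n\int_0^\infty W_j(t)\,dL_j(t)=0$. *)

(* Defs.v *)
From HB Require Import structures.
From mathcomp Require Import all_boot all_order all_algebra.
From mathcomp Require Import all_classical all_reals all_analysis.

Set Implicit Arguments.
Unset Strict Implicit.
Unset Printing Implicit Defensive.

Import Order.TTheory GRing.Theory Num.Theory.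
Import numFieldNormedType.Exports.

Local Open Scope classical_set_scope.
Local Open Scope ring_scope.

(* Paths indexed by [0, +oo) are functions on R whose values at negative times
   are never constrained nor used. *)

Definition cadlag (R : realType) (T : topologicalType) (f : R -> T) : Prop :=
  (forall t : R, 0 <= t -> f @ t^'+ --> f t) /\
  (forall t : R, 0 < t -> exists l : T, f @ t^'- --> l).

Definition nondecreasing_path (R : realType) (f : R -> R) : Prop :=
  forall s t : R, 0 <= s -> s <= t -> f s <= f t.

(* The library's Lebesgue-Stieltjes measures come from functions on the whole
   line; freezing f at the value f 0 on negative times gives no mass to
   (-oo, 0], so the measure below is the usual df when f 0 = 0. *)
Definition freeze (R : realType) (f : R -> R) : R -> R :=
  fun t => f (Num.max 0 t).

Lemma freeze_nondecreasing (R : realType) (f : R -> R) :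
  nondecreasing_path f -> nondecreasing (freeze f).
Proof.
move=> fnd s t st; apply: fnd; first by rewrite le_max lexx.
by rewrite ge_max !le_max lexx st orbT.
Qed.

Lemma freeze_right_continuous (R : realType) (f : R -> R) :
  cadlag f -> right_continuous (freeze f).
Proof.
move=> [frc _] t; have [t0|t0] := leP 0 t.
  have -> : freeze f t = f t by rewrite /freeze max_r.
  apply: cvg_trans (frc t t0); apply: near_eq_cvg.
  near=> s; have ts : t <= s by near: s; exact: nbhs_right_ge.
  by rewrite /freeze max_r// (le_trans t0).
have -> : freeze f t = f 0 by rewrite /freeze max_l// ltW.
apply: cvg_near_cst.
near=> s; have s0 : s <= 0 by near: s; exact: nbhs_right_le.
by rewrite /freeze max_l.
Unshelve. all: by end_near. Qed.

Definition cumulative_of (R : realType) (f : R -> R)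
    (fc : cadlag f) (fnd : nondecreasing_path f) : cumulative R R :=
  HB.pack (freeze f)
    (@isCumulative.Build R _ R (freeze f)
       (freeze_nondecreasing fnd) (freeze_right_continuous fc)).

Definition stieltjes_integral (R : realType) (g f : R -> R)
    (fc : cadlag f) (fnd : nondecreasing_path f) : \bar R :=
  (\int[lebesgue_stieltjes_measure (cumulative_of fc fnd)]_(t in `[0%R, +oo[)
     (g t)%:E)%E.

Lemma cadlag_coord (R : realType) (n : nat) (f : R -> 'cV[R]_n) (j : 'I_n) :
  cadlag f -> cadlag (fun t => f t j 0).
Proof.
have coordP (F : set_system R) (l : 'cV[R]_n) : Filter F ->
    f @ F --> l -> (fun t => f t j 0) @ F --> l j 0.
  move=> FF fl.
  exact: cvg_trans (cvg_app (fun M : 'cV_n => M j 0) fl)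
    (@coord_continuous R n 1 j 0 l).
move=> [frc fll]; split=> [t t0|t t0].
  by apply: coordP; exact: frc.
by have [l fl] := fll t t0; exists (l j 0); exact: coordP.
Qed.

Record skorokhod_solution (R : realType) (n : nat) (Q : 'M[R]_n)
    (Y : R -> 'cV[R]_n) (w : 'cV[R]_n) (W L : R -> 'cV[R]_n) : Prop := {
  sk_cadlag_W : cadlag W;
  sk_cadlag_L : cadlag L;
  sk_balance : forall t : R, 0 <= t -> W t = w + Y t + Q *m L t;
  sk_W_ge0 : forall t : R, 0 <= t -> forall j : 'I_n, 0 <= W t j 0;
  sk_W0 : W 0 = w;
  sk_L0 : L 0 = 0;
  sk_L_nondecreasing : forall j : 'I_n, nondecreasing_path (fun t => L t j 0);
  sk_complementarity :
    (\sum_(j < n) stieltjes_integral (fun t => W t j 0)%R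
       (cadlag_coord j sk_cadlag_L) (sk_L_nondecreasing j) = 0)%E }.

(* Main.v *)
Require Import Defs.
From mathcomp Require Import all_boot all_order all_algebra.
From mathcomp Require Import all_classical all_reals all_analysis.
From mathcomp Require Import measurable_realfun ring lra.

Set Implicit Arguments.
Unset Strict Implicit.
Unset Printing Implicit Defensive.

Import Order.TTheory GRing.Theory Num.Theory.
Import numFieldNormedType.Exports.

Local Open Scope classical_set_scope.
Local Open Scope ring_scope.

(* (N1)-(N2) make the system triangular with one parent per coordinate: W_j is
   X_j + L_j with X_j = w_j + Y_j - p L_i for the unique i < j with p = P i j > 0,
   so each coordinate is a one-dimensional reflection problem driven by its
   parent. In dimension one the regulator is 0 \/ sup (- X_j), and it is the
   smallest one by complementarity. With Z = (I - P')^-1 (w + Y) one has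
   Z_j = w_j + Y_j + p Z_i, and because Y_j is nondecreasing the nested suprema
   in L_i and L_j collapse, so 0 \/ sup (- X_j) = 0 \/ sup (- Z_j). *)

(** * Boundedness and measurability of real cadlag paths *)

Section cadlag_real.
Variable R : realType.
Implicit Types (f : R -> R) (s t : R).

Lemma right_continuous_dist f t (e : R) : f @ t^'+ --> f t -> 0 < e ->
  exists2 d, 0 < d & forall s, t <= s -> s < t + d -> `|f s - f t| < e.
Proof.
move=> /(@cvgr_dist_lt _ R^o) + e0 => /(_ _ e0) -[d /= d0 fe]; exists d => // s.
rewrite le_eqVlt => /predU1P[<-|ts sd]; first by rewrite subrr normr0.
rewrite distrC; apply: fe => //=.
by rewrite distrC ger0_norm ?subr_ge0 ?ltW// ltrBlDl.
Qed.

(** Compactness of [[0, t]]: near each point the right and left limits bound [- f], and these local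
    bounds combine into a uniform one. *)
Lemma cadlag_lbounded f t : cadlag f ->
  exists M, forall s, 0 <= s <= t -> - f s <= M.
Proof.
move=> [frc fll].
have /compact_near_coveringP/(_ R +oo (fun M s => 0 <= s -> s <= t -> - f s <= M))
  := @segment_compact R 0 t.
case.
  move=> u /=; rewrite in_itv/= => /andP[u0 ut].
  have up : \forall s \near u^'+, - f s <= - f u + 1.
    have /(@cvgr_dist_lt _ R^o) := frc _ u0; move=> /(_ 1 ltr01); apply: filterS => s.
    by rewrite ltr_distl => /andP[? ?]; lra.
  have : exists M, \forall s \near u^'-, 0 <= s -> - f s <= M.
    move: u0; rewrite le_eqVlt => /predU1P[<-|u0].
      (* At [u = 0] the left neighbourhood holds only negative times, so any bound does. *)
      exists 0; near=> s => s0; suff : s < 0 by rewrite ltNge s0.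
      by near: s; exact: nbhs_left_lt.
    have [l fl] := fll _ u0; exists (- l + 1).
    move: fl => /(@cvgr_dist_lt _ R^o) /(_ 1 ltr01); apply: filterS => s.
    by rewrite ltr_distl => /andP[? ?] _; lra.
  move=> [M dn].
  have H : \forall s \near u, 0 <= s -> - f s <= Num.max M (- f u + 1).
    move: up dn; rewrite /at_right/at_left !near_withinE => up dn.
    near=> s => s0; rewrite le_max.
    have [su|us|->] := ltgtP s u.
    - by apply/orP; left; move: su s0; near: s.
    - by apply/orP; right; move: us; near: s.
    - by apply/orP; right; rewrite lerDl.
  exists ([set s | 0 <= s -> - f s <= Num.max M (- f u + 1)],
    [set N | Num.max M (- f u + 1) <= N]) => /=.
    by split; [exact: H|exact: nbhs_pinfty_ge (num_real _)].
  by move=> [s N] /= [sM MN] s0 _; rewrite (le_trans _ MN)// sM.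
(* The filter at [+oo] gives the bound only for values strictly above [M]. *)
move=> M [_ MP]. exists (M + 1) => s /andP[s0 st].
apply: MP; rewrite ?ltrDl//=; by rewrite in_itv/= s0.
Unshelve. all: by end_near. Qed.

(** By right continuity, the part of the preimage of []c, +oo[] in [[0, +oo[] is the union of the
    sets [A q] over rational [q], and each [A q] is an interval. *)
Lemma right_continuous_measurable f :
  (forall t, 0 <= t -> f @ t^'+ --> f t) ->
  measurable_fun (`[0, +oo[%classic : set R) f.
Proof.
move=> frc mD; apply: (measurability _ (RGenOInfty.measurableE R)) => //.
move=> _ [_ [c ->] <-].
pose A (q : rat) := [set t | [/\ 0 <= t, t < ratr q &
  forall s, t <= s <= ratr q -> c < f s]].
rewrite [X in measurable X](_ : _ = \bigcup_q A q).
  apply: bigcupT_measurable_rat => q; apply: is_interval_measurable.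
  move=> a b [a0 _ ac] [_ bq bc] y /andP[ay yb]; split.
  - exact: le_trans ay.
  - exact: le_lt_trans bq.
  - by move=> s /andP[ys sq]; apply: ac; rewrite sq (le_trans ay).
apply/seteqP; split => t /=; last first.
  move=> [q _ [t0 tq tf]]; rewrite !in_itv/= !andbT; split => //.
  by apply: tf; rewrite lexx ltW.
rewrite !in_itv/= !andbT => -[t0 ct].
have e0 : 0 < f t - c by rewrite subr_gt0.
have [d d0 H] := right_continuous_dist (frc _ t0) e0.
have td : t < t + d by rewrite ltrDl.
have [q] := rat_in_itvoo td; rewrite in_itv/= => /andP[tq qd].
exists q => //; split => // s /andP[ts sq].
have := H s ts (le_lt_trans sq qd); rewrite ltr_norml => /andP[? ?]; lra.
Qed.

End cadlag_real.

(** * Null sets of Lebesgue-Stieltjes measures *)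

Section stieltjes.
Variable R : realType.
Local Open Scope measure_display_scope.

Section measure.
Variable f : cumulative R R.
Let mu := lebesgue_stieltjes_measure f.

Lemma lebesgue_stieltjes_itvoc (a b : R) : a <= b ->
  mu `]a, b]%classic = (f b - f a)%:E.
Proof.
move=> ab; rewrite /mu /lebesgue_stieltjes_measure /measure_extension/=.
by rewrite measurable_mu_extE/= ?wlength_itv_bnd//; exact: is_ocitv.
Qed.

(** Continuity from above along the half-open intervals [F n] shrinking to [[a, b]]; the bound thus
    takes in a jump of [f] at [a]. *)
Lemma lebesgue_stieltjes_itvcc_ge (a b c : R) : a <= b ->
  (forall s, s < a -> c <= f b - f s) -> (c%:E <= mu `[a, b]%classic)%E.
Proof.
move=> ab H; pose F n := (`]a - n.+1%:R^-1, b]%classic : set R).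
have -> : `[a, b]%classic = \bigcap_n F n.
  apply/seteqP; split => x /=; rewrite /F/= !in_itv/=.
    move=> /andP[ax xb] n _ /=; rewrite in_itv/= xb andbT ltrBlDr.
    by rewrite (le_lt_trans ax)// ltrDl.
  move=> Fx; have := Fx 0 I; rewrite /= in_itv/= => /andP[_ ->]; rewrite andbT.
  rewrite leNgt; apply/negP => /ltr_add_invr[n xna].
  by have := Fx n I; rewrite /= in_itv/= ltrBlDr ltNge (ltW xna).
have FE n : mu (F n) = (f b - f (a - n.+1%:R^-1))%:E.
  by apply: lebesgue_stieltjes_itvoc; rewrite lerBlDr (le_trans ab)// lerDl.
have mF n : measurable (F n) by exact: measurable_itv.
have Fcvg : mu \o F @ \oo --> mu (\bigcap_n F n).
  apply: nonincreasing_cvg_mu => //.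
  - by rewrite [_ (F 0)]FE ltry.
  - by apply: bigcapT_measurable => n; exact: mF.
  - move=> m n mn; apply/subsetPset => x; rewrite /F/= !in_itv/= => /andP[h ->].
    rewrite andbT (le_lt_trans _ h)// lerB// lef_pV2 ?posrE//.
    by rewrite ler_nat.
rewrite -(cvg_lim _ Fcvg)//; apply: lime_ge.
  by apply/cvg_ex; exists (mu (\bigcap_n F n)).
apply: nearW => n /=; rewrite [X in (_ <= X)%E]FE lee_fin; apply: H.
by rewrite ltrBlDr ltrDl.
Qed.

Lemma lebesgue_stieltjes_itvcc_eq0 (a b : R) : a <= b ->
  (forall e, 0 < e -> exists2 s, s < a & f b - f s <= e) ->
  mu `[a, b]%classic = 0%E.
Proof.
move=> ab H; apply/eqP; rewrite -measure_le0; apply/lee_addgt0Pr => e e0.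
rewrite add0e; have [s sa fe] := H _ e0.
have : (mu `[a, b]%classic <= mu `]s, b]%classic)%E.
  apply: le_measure; rewrite ?inE//=.
  by apply: subset_itvr; rewrite bnd_simp.
move=> /le_trans; apply; rewrite lebesgue_stieltjes_itvoc ?lee_fin//.
by rewrite ltW// (lt_le_trans sa).
Qed.

(** Rational right endpoints reduce [A] to countably many sets [B q], each empty or contained in a
    null interval from its infimum [a] to [q]. *)
Lemma negligible_right_null (A : set R) :
  (forall t, A t -> 0 <= t /\ exists2 q, t < q & mu `[t, q]%classic = 0%E) ->
  mu.-negligible A.
Proof.
move=> AP.
pose B (q : R) := [set t : R | [/\ 0 <= t, t <= q & mu `[t, q]%classic = 0%E]].
have negB q : mu.-negligible (B q).
  have [[t0 Bt0]|nB] := pselect (exists t, B q t); last first.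
    rewrite (_ : B q = set0); first exact: negligible_set0.
    by apply/seteqP; split => // t Bt; apply: nB; exists t.
  have infB : has_inf (B q) by split; [exists t0|exists 0 => t []].
  set a := inf (B q).
  have aB t : B q t -> a <= t by move=> Bt; apply: ge_inf => //; exact: infB.2.
  have [Ba|nBa] := pselect (B q a).
    exists `[a, q]%classic; split; [exact: measurable_itv|by case: Ba|].
    by move=> t Bt /=; rewrite in_itv/= aB//=; case: Bt.
  have aq : a <= q by apply: le_trans (aB _ Bt0) _; case: Bt0.
  exists `]a, q]%classic; split; [exact: measurable_itv| |]; last first.
    move=> t Bt /=; rewrite in_itv/= lt_neqAle aB// andbT.
    by case: (Bt) => _ -> _; rewrite andbT; apply/eqP => ta; apply: nBa; rewrite ta.
  apply/eqP; rewrite lebesgue_stieltjes_itvoc// eqe subr_eq0 eq_le.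
  rewrite [X in _ && X](cumulative_is_nondecreasing f _ _ aq) andbT.
  (* By right continuity, a point [t] of [B q] close to [a] has [f t <= f a + e], while nullity of
     [[t, q]] forces [f q <= f t]. *)
  apply/ler_addgt0Pr => e e0.
  have [d fd] := nondecreasing_right_continuousP a f e0.
  have [t Bt td] := inf_adherent (gt0 d) infB.
  apply: le_trans fd; have [_ tq mutq] := Bt.
  have : (mu `]t, q]%classic <= mu `[t, q]%classic)%E.
    by apply: le_measure; rewrite ?inE//=; exact: subset_itv_oc_cc.
  rewrite mutq lebesgue_stieltjes_itvoc// lee_fin subr_le0 => /le_trans; apply.
  exact/(cumulative_is_nondecreasing f)/ltW.
(* Enumerates the rationals by their codes; the default [0] for other integers is harmless, as every
   [B q] is negligible. *)
pose C (n : nat) := B (if @unpickle rat n is Some q then ratr q else 0).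
have negC : mu.-negligible (\bigcup_n C n).
  by apply: (@negligible_bigcup _ _ _ mu C) => n; exact: negB.
apply: (@negligibleS _ _ _ mu _ _ _ negC).
  move=> t /AP[t0 [q tq muq]].
  have [r] := rat_in_itvoo tq; rewrite in_itv/= => /andP[tr rq].
  exists (pickle r) => //; rewrite /C pickleK; split; [by []|exact: ltW|].
  apply/eqP; rewrite -measure_le0 -muq le_measure ?inE//=;
  by apply: subset_itvl; rewrite bnd_simp ltW.
Qed.

End measure.

Lemma stieltjes_integral_eq0P (w l : R -> R) (lc : cadlag l)
    (ln : nondecreasing_path l) :
  cadlag w -> (forall t, 0 <= t -> 0 <= w t) ->
  stieltjes_integral w lc ln = 0%E <->
  (lebesgue_stieltjes_measure (cumulative_of lc ln)).-negligible
    [set t | 0 <= t /\ 0 < w t].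
Proof.
move=> [wrc _] w0; rewrite /stieltjes_integral.
set mu := lebesgue_stieltjes_measure _.
have mD : measurable (`[0, +oo[%classic : set (measurableTypeR R)) by exact: measurable_itv.
have mw : measurable_fun (`[0, +oo[%classic : set (measurableTypeR R)) (EFin \o w).
  by apply/measurable_EFinP; exact: right_continuous_measurable.
have := @ae_eq_integral_abs _ _ _ mu _ mD _ mw.
rewrite (@eq_integral _ _ _ mu _ (EFin \o w)); last first.
  by move=> t; rewrite inE/= in_itv/= andbT => t0; rewrite ger0_norm ?w0.
move=> ->.
rewrite (_ : ae_eq _ _ _ _ = mu.-negligible (~` [set t | `[0, +oo[%classic t -> (w t)%:E = 0%E]))//.
rewrite (_ : (~` _) = [set t | 0 <= t /\ 0 < w t])//.
apply/seteqP; split => t /=; rewrite in_itv/= andbT.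
  move=> /not_implyP[t0 wt]; split => //; rewrite lt_neqAle w0// andbT.
  by apply/eqP => wt0; apply: wt; rewrite -wt0.
by move=> [t0 wt] /(_ t0) [] wt0; rewrite wt0 ltxx in wt.
Qed.

End stieltjes.

(** * One-dimensional reflection: complementarity and minimality *)

Section regulator.
Variable R : realType.
Implicit Types (x w l : R -> R) (s t : R).

(** The one-dimensional Skorokhod regulator of the free path [x]. For [t < 0] the supremum of the
    empty set is [0], so monotonicity holds on the whole line. *)
Definition regulator x t : R := Num.max 0 (sup [set - x s | s in `[0, t]]).

Lemma regulator_ge0 x t : 0 <= regulator x t.
Proof. by rewrite le_max lexx. Qed.

Lemma regulator_ub x s t : cadlag x -> 0 <= s <= t -> - x s <= regulator x t.
Proof.
move=> xc st; have [M xM] := cadlag_lbounded t xc; rewrite le_max; apply/orP; right.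
apply: ub_le_sup; last by exists s => //=; rewrite in_itv/=.
by exists M => _ [u /= + <-]; rewrite in_itv/=; exact: xM.
Qed.

Lemma regulator_le x t c : 0 <= c -> (forall s, 0 <= s <= t -> - x s <= c) ->
  regulator x t <= c.
Proof.
move=> c0 xc; rewrite ge_max c0/=.
have [t0|t0] := leP 0 t; last by rewrite set_itv_ge -?ltNge// image_set0 sup0.
apply: ge_sup; first by exists (- x 0), 0 => //=; rewrite in_itv/= lexx.
by move=> _ [u /= + <-]; rewrite in_itv/=; exact: xc.
Qed.

Lemma regulator_nondecreasing x s t : cadlag x -> s <= t ->
  regulator x s <= regulator x t.
Proof.
move=> xc st; apply: regulator_le; first exact: regulator_ge0.
move=> u /andP[u0 us]; apply: regulator_ub => //.
by rewrite u0 (le_trans us).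
Qed.

Lemma regulator0 x : cadlag x -> 0 <= x 0 -> regulator x 0 = 0.
Proof.
move=> xc x0; apply/eqP; rewrite eq_le regulator_ge0 andbT regulator_le// => s s0.
by rewrite (_ : s = 0) ?oppr_le0//; apply/eqP; rewrite eq_le andbC.
Qed.

(** Just after [t], [- x] stays below [- x t + e], so the running maximum rises by at most [e]. Left
    limits come from monotonicity. *)
Lemma regulator_cadlag x : cadlag x -> cadlag (regulator x).
Proof.
move=> xc; split=> [t t0|t t0].
  apply/(@cvgrPdist_le _ R^o) => e e0.
  have [d d0 xd] := right_continuous_dist (xc.1 t t0) e0.
  near=> s; have ts : t <= s by near: s; exact: nbhs_right_ge.
  have sd : s < t + d by near: s; apply: nbhs_right_lt; rewrite ltrDl.
  rewrite distrC ger0_norm ?subr_ge0 ?regulator_nondecreasing//.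
  rewrite lerBlDr; apply: regulator_le => [|u /andP[u0 us]].
    by rewrite addr_ge0 ?regulator_ge0// ltW.
  have [ut|tu] := leP u t.
    by rewrite ler_wpDl ?(ltW e0)// regulator_ub// u0.
  have := xd u (ltW tu) (le_lt_trans us sd); rewrite ltr_norml => /andP[? _].
  have : - x t <= regulator x t by apply: regulator_ub; rewrite // t0 lexx.
  lra.
apply/cvg_ex; apply: nondecreasing_at_left_is_cvgr.
  by near=> s => a b _ _; exact: regulator_nondecreasing.
near=> s; exists (regulator x t) => _ [u /= + <-]; rewrite in_itv/= => /andP[_ ut].
exact/regulator_nondecreasing/ltW.
Unshelve. all: by end_near. Qed.

(** Each time [t] with [w t > 0] starts a null interval [[t, q]] with [q > t], so
    [negligible_right_null] applies to the set of such times. *)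
Lemma regulator_complementarity x w l (lc : cadlag l)
    (ln : nondecreasing_path l) : l = regulator x ->
  cadlag x -> cadlag w -> (forall t, 0 <= t -> w t = x t + l t) ->
  stieltjes_integral w lc ln = 0%E.
Proof.
move=> lE xc wc wE.
have xl s t : 0 <= s -> s <= t -> - x s <= l t.
  by move=> *; rewrite lE regulator_ub//; apply/andP.
have w0 t : 0 <= t -> 0 <= w t.
  by move=> t0; rewrite wE// -lerBlDl sub0r xl.
apply/stieltjes_integral_eq0P => //.
apply: negligible_right_null => t [t0 wt]; split => //.
have e0 : 0 < w t / 2 by rewrite divr_gt0.
have [d d0 wd] := right_continuous_dist (wc.1 t t0) e0.
exists (t + d / 2); first by rewrite ltrDl divr_gt0.
have td : t <= t + d / 2 by rewrite lerDl divr_ge0// ltW.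
(* past [t], the regulator only grows where [w] is small *)
have lt : l (t + d / 2) = l t.
  have [//|ltd] := leP (l (t + d / 2)) (l t).
    by move=> h; apply/eqP; rewrite eq_le h ln.
  have : l (t + d / 2) <= Num.max (l t) (l (t + d / 2) - w t / 2).
    rewrite {1}lE; apply: regulator_le => [|s /andP[s0 sd]]; rewrite le_max.
      by rewrite lE regulator_ge0.
    have [st|ts] := leP s t; first by rewrite xl.
    have sd' : s < t + d by apply: le_lt_trans sd _; lra.
    have := wd _ (ltW ts) sd'; rewrite ltr_norml (wE s)// => /andP[? _].
    have : l s <= l (t + d / 2) by exact: ln.
    by move=> ?; apply/orP; right; lra.
  by rewrite le_max => /orP[|]; lra.
apply: lebesgue_stieltjes_itvcc_eq0 => // e e0'.
(* It remains to exclude a jump of [l] at [t]. If all earlier values were below [l t - e], the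
   supremum defining [l t] would be at most the larger of [l t - e] and [- x t = l t - w t], both
   below [l t]. *)
apply: contrapT => H.
have {}H s : s < t -> l (Num.max 0 s) < l t - e.
  move=> st; rewrite ltNge; apply/negP => le; apply: H; exists s => //.
  rewrite /= /freeze (@max_r _ _ 0 (t + d / 2)) ?(le_trans t0)// lt.
  by rewrite lerBlDl -lerBlDr.
have l0 : 0 <= l t - e.
  have : t - 1 < t by lra.
  by move=> /H/ltW; apply: le_trans; rewrite lE; exact: regulator_ge0.
have : l t <= Num.max (l t - e) (l t - w t).
  rewrite {1}lE; apply: regulator_le => [|s /andP[s0]]; rewrite le_max ?l0//.
  rewrite le_eqVlt => /predU1P[->|st]; first by apply/orP; right; rewrite wE//; lra.
  have := H _ st; rewrite max_r// => h.
  by rewrite (le_trans (xl s s s0 (lexx _)))//; exact: ltW.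
by rewrite le_max => /orP[|]; lra.
Qed.

(* If [l t < l' t], then [w' > w >= 0] between the last time [tau] at which
   [l' <= l t] and [t], so complementarity forbids [l'] to grow there. *)
Lemma reflection_minimal x w l w' l' (lc' : cadlag l')
    (ln' : nondecreasing_path l') :
  nondecreasing_path l -> l 0 = 0 -> l' 0 = 0 ->
  (forall t, 0 <= t -> w t = x t + l t) ->
  (forall t, 0 <= t -> w' t = x t + l' t) ->
  cadlag w' -> (forall t, 0 <= t -> 0 <= w t) ->
  (forall t, 0 <= t -> 0 <= w' t) ->
  stieltjes_integral w' lc' ln' = 0%E ->
  forall t, 0 <= t -> l' t <= l t.
Proof.
move=> ln l0 l'0 wE wE' wc' w0 w0'.
move=> /(stieltjes_integral_eq0P _ _ wc' w0').
set mu := lebesgue_stieltjes_measure _ => neg t t0.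
rewrite leNgt; apply/negP => ltl'.
have lt0 : 0 <= l t by rewrite -l0 ln.
pose S := [set s | 0 <= s <= t /\ l' s <= l t].
have S0 : S 0 by split; rewrite ?lexx// l'0.
have supS : has_sup S by split; [exists 0|exists t => s [/andP[]]].
set tau := sup S.
have tau0 : 0 <= tau by apply: ub_le_sup => //; exact: supS.2.
have taut : tau <= t by apply: ge_sup; [exists 0|move=> s [/andP[]]].
have w'gt s : 0 <= s -> s <= t -> l t < l' s -> 0 < w' s.
  move=> s0 st lts; have := w0 s s0; rewrite wE// wE'//.
  have : l s <= l t by exact: ln.
  lra.
have up s : tau < s -> s <= t -> 0 < w' s.
  move=> taus st; have s0 : 0 <= s by rewrite (le_trans tau0)// ltW.
  apply: w'gt => //; rewrite ltNge; apply/negP => l's.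
  have : s <= tau by apply: ub_le_sup; [exact: supS.2|split; rewrite ?s0].
  by rewrite leNgt taus.
have null (A : set (measurableTypeR R)) :
    measurable A -> (forall s, A s -> 0 <= s /\ 0 < w' s) -> mu A = 0%E.
  move=> mA Aw; apply: (negligibleP mu mA).1.
  exact: (@negligibleS _ _ _ mu _ _ _ neg).
have fr s : 0 <= s -> freeze l' s = l' s by move=> s0; rewrite /freeze max_r.
(* If [l'] has not passed the level [l t] at [tau], nullity of []tau, t]] gives
   [l' t = l' tau <= l t]. Otherwise [w' tau > 0], and [[tau, t]] is null with the jump at [tau]
   included. *)
have [l'tau|l'tau] := leP (l' tau) (l t).
  have : mu `]tau, t]%classic = 0%E.
    apply: null => [|s /=]; first exact: measurable_itv.
    rewrite in_itv/= => /andP[ts st]; split; last exact: up.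
    by rewrite (le_trans tau0)// ltW.
  rewrite /mu lebesgue_stieltjes_itvoc//= !fr// => -[] /eqP.
  by rewrite subr_eq0 => /eqP; lra.
have mu0 : mu `[tau, t]%classic = 0%E.
  apply: null => [|s /=]; first exact: measurable_itv.
  rewrite in_itv/= => /andP[]; rewrite le_eqVlt => /predU1P[<-|ts] st.
    by split => //; exact: w'gt.
  by split; [rewrite (le_trans tau0)// ltW|exact: up].
have : ((l' t - l t)%:E <= mu `[tau, t]%classic)%E.
  apply: lebesgue_stieltjes_itvcc_ge => // s stau; rewrite /= fr// lerB//.
  have [s0|s0] := leP 0 s; last by rewrite /freeze max_l ?l'0// ltW.
  have taus : 0 < tau - s by rewrite subr_gt0.
  rewrite fr//; have [u [/andP[u0 ut] l'u]] := sup_adherent taus supS.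
  by rewrite -/tau subKr => /ltW su; exact: le_trans (ln' _ _ s0 su) l'u.
by rewrite mu0 lee_fin; lra.
Qed.

End regulator.

(** * Closure properties of cadlag paths *)

Section cadlag_closure.
Variable R : realType.
Implicit Types f g : R -> R.

Lemma cadlag_cst (c : R) : cadlag (fun _ : R => c).
Proof. by split=> [t _|t _]; [|exists c]; exact: cvg_cst. Qed.

Lemma cadlagD f g : cadlag f -> cadlag g -> cadlag (fun t => f t + g t).
Proof.
move=> [fr fl] [gr gl]; split=> t t0; first by apply: cvgD; [exact: fr|exact: gr].
have [[a fa] [b gb]] := (fl t t0, gl t t0).
by exists (a + b); exact: cvgD.
Qed.

Lemma cadlagZ (c : R) f : cadlag f -> cadlag (fun t => c * f t).
Proof.
move=> [fr fl]; split=> t t0.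
  by apply: cvgM; [exact: cvg_cst|exact: fr].
have [a fa] := fl t t0.
by exists (c * a); apply: cvgM => //; exact: cvg_cst.
Qed.

Lemma cadlag_sum (I : Type) (r : seq I) (F : I -> R -> R) :
  (forall i, cadlag (F i)) -> cadlag (fun t => \sum_(i <- r) F i t).
Proof.
move=> Fc; elim: r => [|i r IH].
  by under eq_fun do rewrite big_nil; exact: cadlag_cst.
by under eq_fun do rewrite big_cons; exact: cadlagD.
Qed.

Lemma cadlag_cV (n : nat) (f : R -> 'cV[R]_n) :
  (forall j, cadlag (fun t => f t j 0)) -> cadlag f.
Proof.
have coordP (F : set_system R) (l : 'cV[R]_n) : Filter F ->
    (forall j, (fun t => f t j 0) @ F --> l j 0) -> f @ F --> l.
  move=> FF fl A [P lP PA].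
  have : \forall t \near F, forall j, P j 0 (f t j 0).
    by apply: filter_forall => j; apply: fl; exact: lP.
  by apply: filterS => t Pt; apply: PA => i j; rewrite ord1.
move=> fc; split=> t t0.
  by apply: coordP => j; have [+ _] := fc j; exact.
have /choice[l fl] : forall j, exists l : R, (fun t => f t j 0) @ t^'- --> l.
  by move=> j; have [_ +] := fc j; exact.
by exists (\col_j l j); apply: coordP => j; rewrite mxE; exact: fl.
Qed.

End cadlag_closure.

(** * Componentwise complementarity and nested regulators *)

Section skorokhod.
Variable R : realType.

Lemma stieltjes_integral_ge0 (g f : R -> R) (fc : cadlag f)
    (fnd : nondecreasing_path f) :
  (forall t, 0 <= t -> 0 <= g t) -> (0 <= stieltjes_integral g fc fnd)%E.
Proof.
by move=> g0; apply: integral_ge0 => t /=; rewrite in_itv/= andbT lee_fin; exact: g0.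
Qed.

(** A vanishing sum of nonnegative integrals vanishes termwise, which gives the input of the
    one-dimensional minimality. *)
Lemma skorokhod_complementarity (n : nat) (Q : 'M[R]_n) Y w W L
    (S : skorokhod_solution Q Y w W L) (j : 'I_n) :
  stieltjes_integral (fun t => W t j 0)
    (cadlag_coord j (sk_cadlag_L S))
    (@sk_L_nondecreasing _ _ _ _ _ _ _ S j) = 0%E.
Proof.
have /eqP := sk_complementarity S; rewrite seq_psume_eq0.
  by move=> /allP/(_ j (mem_index_enum _))/= /eqP.
by move=> i _; apply: stieltjes_integral_ge0 => t t0; exact: (sk_W_ge0 S).
Qed.

(* For nondecreasing [y], a running supremum of [- (a + y + p z)] may be taken
   after replacing [- z] by its own running maximum. *)
Lemma regulator_nested (z y : R -> R) (a p : R) :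
  0 <= a -> 0 < p -> cadlag z -> cadlag y -> nondecreasing_path y -> y 0 = 0 ->
  regulator (fun t => a + y t + p * z t) =
  regulator (fun t => a + y t - p * regulator z t).
Proof.
move=> a0 p0 zc yc ynd y0; apply/funext => t.
have c1 : cadlag (fun t => a + y t + p * z t).
  by apply: cadlagD (cadlagZ p zc); apply: cadlagD yc; exact: cadlag_cst.
have c2 : cadlag (fun t => a + y t - p * regulator z t).
  under eq_fun do rewrite -mulNr.
  apply: cadlagD (cadlagZ (- p) (regulator_cadlag zc)).
  by apply: cadlagD yc; exact: cadlag_cst.
apply/eqP; rewrite eq_le; apply/andP; split.
  apply: regulator_le; first exact: regulator_ge0.
  move=> s s0t; have /andP[s0 st] := s0t.
  apply: le_trans (regulator_ub c2 s0t).
  rewrite lerN2 lerD2l -mulrN ler_pM2l// lerNl; apply: regulator_ub => //.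
  by rewrite s0 lexx.
set r := (X in _ <= X).
apply: regulator_le; first exact: regulator_ge0.
move=> s /andP[s0 st].
have r0 : 0 <= r by exact: regulator_ge0.
have ys : 0 <= y s by rewrite -y0 ynd.
(* The wanted inequality solved for [regulator z s]. For [u <= s], [- (p * z u) <= r + a + y u <= r
   + a + y s]; the right side is nonnegative, which handles the maximum with [0]. *)
have : regulator z s <= p^-1 * (r + a + y s).
  apply: regulator_le; first by rewrite mulr_ge0 ?invr_ge0 ?(ltW p0)// !addr_ge0.
  move=> u /andP[u0 us]; rewrite ler_pdivlMl//.
  have : y u <= y s by exact: ynd.
  have : - (a + y u + p * z u) <= r.
    by apply: (regulator_ub c1); rewrite u0 (le_trans us).
  lra.
by rewrite ler_pdivlMl//; lra.
Qed.

End skorokhod.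

(** * Existence through the explicit formula, and uniqueness *)

Theorem theorem5p1 (R : realType) (n : nat) (P : 'M[R]_n)
    (Y : R -> 'cV[R]_n) (w : 'cV[R]_n)
    (P_ge0 : forall i j : 'I_n, 0 <= P i j)
    (Y_cadlag : cadlag Y)
    (Y0 : Y 0 = 0)
    (w_ge0 : forall j : 'I_n, 0 <= w j 0)
    (N1 : forall i j : 'I_n, (j <= i)%N -> P i j = 0)
    (N2 : forall j : 'I_n, (0 < j)%N -> exists! i : 'I_n, 0 < P i j)
    (N3 : forall j : 'I_n, (0 < j)%N -> nondecreasing_path (fun t => Y t j 0)) :
  let Q : 'M[R]_n := 1%:M - P^T in
  let L (t : R) : 'cV[R]_n :=
    \col_j Num.max 0
      (sup [set (- (invmx Q *m Y s) - invmx Q *m w) j 0 | s in `[0, t]]) in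
  let W (t : R) : 'cV[R]_n := w + Y t + Q *m L t in
  skorokhod_solution Q Y w W L /\
  (forall W' L' : R -> 'cV[R]_n, skorokhod_solution Q Y w W' L' ->
     forall t : R, 0 <= t -> W' t = W t /\ L' t = L t).
Proof.
move=> Q L W.
have QE (v : 'cV[R]_n) j : (Q *m v) j 0 = v j 0 - \sum_i P i j * v i 0.
  rewrite mulmxBl mul1mx !mxE; congr (_ - _).
  by apply: eq_bigr => i _; rewrite mxE.
(* [Q] is lower triangular with unit diagonal, so its determinant is [1]. *)
have Qu : Q \in unitmx.
  rewrite unitmxE det_trig ?big1 ?unitr1// => [i _|].
    by rewrite !mxE eqxx N1// subr0.
  apply/is_trig_mxP => i j ij; rewrite !mxE N1 ?(ltnW ij)// subr0.
  by rewrite (_ : i == j = false)//; apply: contraTF ij => /eqP ->; rewrite ltnn.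
pose Z j t := (invmx Q *m (w + Y t)) j 0.
have ZE j t : Z j t = w j 0 + Y t j 0 + \sum_i P i j * Z i t.
  have := QE (invmx Q *m (w + Y t)) j; rewrite mulKVmx// mxE => ->.
  by rewrite subrK.
have LE t j : L t j 0 = regulator (Z j) t.
  rewrite mxE /regulator; congr (Num.max 0 (sup _)).
  apply: eq_imagel => s _; rewrite /Z mulmxDr !mxE; ring.
have Yc j : cadlag (fun t => Y t j 0) by exact: cadlag_coord.
have Zc j : cadlag (Z j).
  rewrite (_ : Z j = fun t => \sum_i invmx Q j i * (w i 0 + Y t i 0)).
    by apply: cadlag_sum => i; apply/cadlagZ/cadlagD => //; exact: cadlag_cst.
  by apply/funext => t; rewrite /Z mxE; apply: eq_bigr => i _; rewrite mxE.
(* The free path of coordinate [j] under the regulators [L']; by [N1] only indices below [j]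
   contribute to the sum. *)
pose X (L' : R -> 'cV[R]_n) j t := w j 0 + Y t j 0 - \sum_i P i j * L' t i 0.
have Xc (L' : R -> 'cV[R]_n) j : cadlag L' -> cadlag (X L' j).
  move=> L'c; rewrite (_ : X L' j =
    fun t => w j 0 + Y t j 0 + -1 * \sum_i P i j * L' t i 0).
    apply: cadlagD; first by apply: cadlagD => //; exact: cadlag_cst.
    by apply/cadlagZ/cadlag_sum => i; apply/cadlagZ/cadlag_coord.
  by apply/funext => t; rewrite mulN1r.
have balE (W' L' : R -> 'cV[R]_n) t j :
    W' t = w + Y t + Q *m L' t -> W' t j 0 = X L' j t + L' t j 0.
  by move=> ->; rewrite mxE QE mxE /X; ring.
have LX j : regulator (Z j) = regulator (X L j).
  (* Coordinate [0] has no parent, so both paths reduce to [w j 0 + Y t j 0]. *)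
  have [j0|j0] := posnP j.
    congr regulator; apply/funext => t; rewrite ZE /X !big1 ?subr0 ?addr0// => i _;
      by rewrite N1 ?mul0r// j0.
  have [i [Pij iP]] := N2 j j0.
  (* Nonnegativity turns uniqueness of the positive entry into vanishing of all others. *)
  have sumP (a : 'I_n -> R) : \sum_k P k j * a k = P i j * a i.
    rewrite (bigD1 i)//= big1 ?addr0// => k ki.
    have [/iP ik|] := ltP 0 (P k j); first by rewrite ik eqxx in ki.
    by move=> Pk; rewrite (_ : P k j = 0) ?mul0r//; apply/eqP; rewrite eq_le Pk P_ge0.
  rewrite (_ : Z j = fun t => w j 0 + Y t j 0 + P i j * Z i t); last first.
    by apply/funext => t; rewrite ZE sumP.
  rewrite (_ : X L j = fun t => w j 0 + Y t j 0 - P i j * regulator (Z i) t); last first.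
    by apply/funext => t; rewrite /X sumP LE.
  by apply: regulator_nested => //; [exact: N3|rewrite Y0 mxE].
(* Strong induction: [Z j 0] is [w j 0] plus nonnegative multiples of [Z i 0] with [i < j]. This
   yields [L 0 = 0]. *)
have Z0 j : 0 <= Z j 0.
  have [m] := ubnP j; elim: m j => // m IH j; rewrite ltnS => jm.
  rewrite ZE Y0 mxE addr0 addr_ge0// sumr_ge0// => i _.
  have [ij|ji] := ltnP i j; last by rewrite N1// mul0r.
  by rewrite mulr_ge0// IH// (leq_trans ij).
have Lc : cadlag L.
  apply: cadlag_cV => j; under eq_fun do rewrite LE.
  exact: regulator_cadlag.
have Lnd j : nondecreasing_path (fun t => L t j 0).
  by move=> s t _ st; rewrite !LE; exact: regulator_nondecreasing.
have L0 : L 0 = 0.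
  by apply/colP => j; rewrite LE regulator0// mxE.
have WE t j : W t j 0 = X L j t + L t j 0 by exact: balE.
have Wc : cadlag W.
  apply: cadlag_cV => j; under eq_fun do rewrite WE.
  by apply: cadlagD; [exact: Xc|exact: cadlag_coord].
have W_ge0 t : 0 <= t -> forall j, 0 <= W t j 0.
  move=> t0 j; rewrite WE LE LX -lerBlDl sub0r.
  by apply: regulator_ub; [exact: Xc|rewrite t0 lexx].
have LS : skorokhod_solution Q Y w W L.
  refine (@Build_skorokhod_solution _ _ _ _ _ _ _ Wc Lc _ W_ge0 _ L0 Lnd _) => //.
    by rewrite /W L0 mulmx0 Y0 !addr0.
  apply: big1 => j _; apply: (@regulator_complementarity _ (X L j)) => //.
  - by apply/funext => t; rewrite LE LX.
  - exact: Xc.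
  - exact: cadlag_coord.
split=> // W' L' S'.
(* Strong induction on [j]: once the regulators agree below [j], both solutions have the free path
   [X L' j] there, and minimality in both directions gives equality. *)
have LL j t : 0 <= t -> L' t j 0 = L t j 0.
  have [m] := ubnP j; elim: m j t => // m IH j t; rewrite ltnS => jm t0.
  have W'E s : 0 <= s -> W' s j 0 = X L' j s + L' s j 0.
    by move=> s0; apply/balE/(sk_balance S').
  have WE' s : 0 <= s -> W s j 0 = X L' j s + L s j 0.
    move=> s0; rewrite WE; congr (_ - _ + _); apply: eq_bigr => i _.
    have [ij|ji] := ltnP i j; last by rewrite N1// !mul0r.
    by rewrite IH// (leq_trans ij).
  have L'0 : L' 0 j 0 = 0 by rewrite (sk_L0 S') mxE.
  have L0' : L 0 j 0 = 0 by rewrite L0 mxE.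
  apply/eqP; rewrite eq_le; apply/andP; split.
    apply: (reflection_minimal _ L0' L'0 WE' W'E _ _ _
      (skorokhod_complementarity S' j)) => //.
    - exact/cadlag_coord/(sk_cadlag_W S').
    - by move=> s s0; exact: W_ge0.
    - by move=> s s0; exact: (sk_W_ge0 S').
  apply: (reflection_minimal _ L'0 L0' W'E WE' _ _ _
    (skorokhod_complementarity LS j)) => //.
  - exact: (sk_L_nondecreasing S').
  - exact/cadlag_coord.
  - by move=> s s0; exact: (sk_W_ge0 S').
  - by move=> s s0; exact: W_ge0.
move=> t t0; have LL' : L' t = L t by apply/colP => j; exact: LL.
by rewrite (sk_balance S')// LL'.
Qed.
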